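(* Let $k$ be an algebraically closed field of characteristic zero. Let $R=R_0^2-R_1^2\in k[u,v,w]$, where $$R_0=27(u^2+v^2)+6uv-w^2-36(u+v)uvw+(u+v)w^3-16u^3v^3+8u^2v^2w^2-uvw^4,$$ $$R_1=16-18(u+v)w+48u^2v^2+20uvw^2.$$ For $[\lambda,\mu,\xi]\in k^3$, the quartic form $$f^{\lambda,\mu,\xi}=x^3y+y^3z+z^3t+t^3x+\lambda x^2z^2+\mu y^2t^2+\xi xyzt\in k[x,y,z,t]$$ is singular if and only if $R(\lambda,\mu,\xi)=0$.
   Context: A nonzero form $f\in k[x,y,z,t]$ is nonsingular if the projective algebraic set $V_p(f)\subset\mathbf{P}^3(k)$ is nonsingular, i.e. the four partial derivatives of $f$ have no common zero in $k^4\setminus\{0\}$; otherwise it is singular. *)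

(* Defs.v *)
From HB Require Import structures.
From mathcomp Require Import all_boot all_order all_algebra.
From mathcomp Require Import mpoly.

Set Implicit Arguments.
Unset Strict Implicit.
Unset Printing Implicit Defensive.

Import GRing.Theory.
Local Open Scope ring_scope.

(* Intended for nonzero forms: over an algebraically closed field [k] a zero
   [p != 0] of all the partial derivatives represents a singular point of the
   projective hypersurface [f = 0]. *)
Definition nonsingular (n : nat) (k : fieldType) (f : {mpoly k[n]}) : Prop :=
  forall p : 'rV[k]_n,
    (forall i : 'I_n, (f^`M(i)).@[fun j => p 0 j] = 0) -> p = 0.

Definition singular (n : nat) (k : fieldType) (f : {mpoly k[n]}) : Prop :=
  ~ nonsingular f.

Definition quartic (k : fieldType) (lambda mu xi : k) : {mpoly k[4]} :=
  let x : {mpoly k[4]} := 'X_(@Ordinal 4 0 isT) in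
  let y : {mpoly k[4]} := 'X_(@Ordinal 4 1 isT) in
  let z : {mpoly k[4]} := 'X_(@Ordinal 4 2 isT) in
  let t : {mpoly k[4]} := 'X_(@Ordinal 4 3 isT) in
  x ^+ 3 * y + y ^+ 3 * z + z ^+ 3 * t + t ^+ 3 * x
  + lambda *: (x ^+ 2 * z ^+ 2) + mu *: (y ^+ 2 * t ^+ 2)
  + xi *: (x * y * z * t).

Definition R0 (k : fieldType) : {mpoly k[3]} :=
  let u : {mpoly k[3]} := 'X_(@Ordinal 3 0 isT) in
  let v : {mpoly k[3]} := 'X_(@Ordinal 3 1 isT) in
  let w : {mpoly k[3]} := 'X_(@Ordinal 3 2 isT) in
  27%:R * (u ^+ 2 + v ^+ 2) + 6%:R * u * v - w ^+ 2
  - 36%:R * (u + v) * u * v * w + (u + v) * w ^+ 3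
  - 16%:R * u ^+ 3 * v ^+ 3 + 8%:R * u ^+ 2 * v ^+ 2 * w ^+ 2
  - u * v * w ^+ 4.

Definition R1 (k : fieldType) : {mpoly k[3]} :=
  let u : {mpoly k[3]} := 'X_(@Ordinal 3 0 isT) in
  let v : {mpoly k[3]} := 'X_(@Ordinal 3 1 isT) in
  let w : {mpoly k[3]} := 'X_(@Ordinal 3 2 isT) in
  16%:R - 18%:R * (u + v) * w + 48%:R * u ^+ 2 * v ^+ 2
  + 20%:R * u * v * w ^+ 2.

Definition R (k : fieldType) : {mpoly k[3]} := R0 k ^+ 2 - R1 k ^+ 2.

(* Main.v *)
Require Import Defs.
From mathcomp Require Import all_boot all_order all_algebra.
From mathcomp Require Import mpoly.
From mathcomp Require Import ring.

Set Implicit Arguments.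
Unset Strict Implicit.
Unset Printing Implicit Defensive.

Import GRing.Theory.
Local Open Scope ring_scope.

(** Multiplying the partial derivatives of the quartic by the corresponding
    variables gives linear relations between monomials, from which
    [10 (x^3 y - z^3 t) = 0], so that [x^3 y = z^3 t] and [y^3 z = t^3 x] at a
    singular point.  If a coordinate of the point vanishes, then so do all of
    them.  Otherwise [a = x^2 / (z t)] and [e = x y^2 / (z t^2)] satisfy
    [e^2 = 1], and [a] is a common root of the cubics
    [2 lambda X^3 + 3 X^2 + xi X + e] and [X^3 + xi X^2 + 3 e X + 2 mu].
    Conversely such a common root [a] yields the singular point
    [(a, 1, e a, e)].  The resultant of the two cubics is [4 (R0 + e R1)]. *)

(** * Common roots of the two cubics *)

Lemma monic_cubic_split (k : closedFieldType) (b c d : k) :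
  exists x1 x2 x3 : k,
    [/\ b = - (x1 + x2 + x3), c = x1 * x2 + x1 * x3 + x2 * x3
      & d = - (x1 * x2 * x3)].
Proof.
(* [x1] is a root of the cubic, [x2] a root of its quotient by [X - x1]; the sum of the roots forces
   the third. *)
have [x1 hx1] := @solve_monicpoly k 3%N (nth 0 [:: - d; - c; - b]) isT.
have [x2 hx2] :=
  @solve_monicpoly k 2%N (nth 0 [:: - (c + x1 * (b + x1)); - (b + x1)]) isT.
rewrite !big_ord_recr !big_ord0 /= in hx1 hx2.
exists x1, x2, (- b - x1 - x2); split; first by ring.
- by apply/subr0_eq; move/eqP: hx2; rewrite -subr_eq0 => /eqP <-; ring.
- have -> : x1 * x2 * (- b - x1 - x2) = x1 * (- x2 ^+ 2 - (b + x1) * x2) by ring.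
  by apply/subr0_eq; rewrite hx2; move/eqP: hx1; rewrite -subr_eq0 => /eqP hx1;
    rewrite -[RHS]hx1; ring.
Qed.

Definition common_root (k : fieldType) (u v w e a : k) :=
  2%:R * u * a ^+ 3 + 3%:R * a ^+ 2 + w * a + e = 0
  /\ a ^+ 3 + w * a ^+ 2 + 3%:R * e * a + 2%:R * v = 0.

Section Cubics.

Variables (k : closedFieldType) (u v w : k).

Let r0 : k := 27%:R * (u ^+ 2 + v ^+ 2) + 6%:R * u * v - w ^+ 2
  - 36%:R * (u + v) * u * v * w + (u + v) * w ^+ 3
  - 16%:R * u ^+ 3 * v ^+ 3 + 8%:R * u ^+ 2 * v ^+ 2 * w ^+ 2
  - u * v * w ^+ 4.

Let r1 : k := 16%:R - 18%:R * (u + v) * w + 48%:R * u ^+ 2 * v ^+ 2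
  + 20%:R * u * v * w ^+ 2.

(* Subtracting [2 u] times the second cubic from the first leaves the quadratic
   [c2 X^2 + c1 X + c0] with the same values at the roots. *)
Lemma cubic_resultant (e x1 x2 x3 : k) :
    e ^+ 2 = 1 ->
    w = - (x1 + x2 + x3) -> 3%:R * e = x1 * x2 + x1 * x3 + x2 * x3 ->
    2%:R * v = - (x1 * x2 * x3) ->
  let f x := 2%:R * u * x ^+ 3 + 3%:R * x ^+ 2 + w * x + e in
  f x1 * f x2 * f x3 = 4%:R * (r0 + e * r1).
Proof.
move=> he h1 h2 h3 f.
pose c2 := 3%:R - 2%:R * u * w; pose c1 := w - 6%:R * u * e.
pose c0 := e - 4%:R * u * v; pose q x := c2 * x ^+ 2 + c1 * x + c0.
have fq x : (x - x1) * (x - x2) * (x - x3) = 0 -> f x = q x.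
  move=> hx.
  have {hx}hx : x ^+ 3 + w * x ^+ 2 + 3%:R * e * x + 2%:R * v = 0.
    by rewrite h1 h2 h3 -hx; ring.
  by apply/subr0_eq; rewrite -[RHS](mulr0 (2%:R * u)) -hx /f /q /c2 /c1 /c0; ring.
rewrite !fq ?subrr ?mulr0 ?mul0r //.
(* The product is symmetric in the roots; written in elementary symmetric functions, it becomes a
   polynomial in the coefficients by Vieta. *)
have -> : q x1 * q x2 * q x3 =
  let s1 := x1 + x2 + x3 in let s2 := x1 * x2 + x1 * x3 + x2 * x3 in
  let s3 := x1 * x2 * x3 in
  c2 ^+ 3 * s3 ^+ 2 + c2 ^+ 2 * c1 * s2 * s3
  + c2 ^+ 2 * c0 * (s2 ^+ 2 - 2%:R * s1 * s3) + c2 * c1 ^+ 2 * s1 * s3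
  + c2 * c1 * c0 * (s1 * s2 - 3%:R * s3) + c2 * c0 ^+ 2 * (s1 ^+ 2 - 2%:R * s2)
  + c1 ^+ 3 * s3 + c1 ^+ 2 * c0 * s2 + c1 * c0 ^+ 2 * s1 + c0 ^+ 3.
  by rewrite /q /=; ring.
have -> : x1 + x2 + x3 = - w by rewrite h1 opprK.
have -> : x1 * x2 * x3 = - (2%:R * v) by rewrite h3 opprK.
rewrite -h2 /= /c2 /c1 /c0 /r0 /r1.
(* The identity holds only modulo [e ^+ 2 = 1], so it is checked at [e = 1] and [e = -1]. *)
have /eqP := he; rewrite sqrf_eq1 => /orP[] /eqP ->; ring.
Qed.

(** The product of the values of the first cubic at the three roots of the second vanishes exactly
    when one of these roots is common. *)
Lemma common_rootP (e : k) : 2%:R != 0 :> k -> e ^+ 2 = 1 ->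
  r0 + e * r1 = 0 <-> exists a, common_root u v w e a.
Proof.
move=> n2 he.
have [x1 [x2 [x3 [h1 h2 h3]]]] := monic_cubic_split w (3%:R * e) (2%:R * v).
have hres := cubic_resultant he h1 h2 h3.
have g0 x : x ^+ 3 + w * x ^+ 2 + 3%:R * e * x + 2%:R * v
    = (x - x1) * (x - x2) * (x - x3) by rewrite h1 h2 h3; ring.
split=> [h | [a [fa ga]]].
  move: hres; rewrite h mulr0 => /eqP; rewrite !mulf_eq0 -orbA.
  by case/or3P=> /eqP fx; [exists x1 | exists x2 | exists x3]; split=> //;
    rewrite g0 subrr ?mulr0 ?mul0r.
have n4 : 4%:R != 0 :> k by rewrite (natrM _ 2 2) mulf_neq0.
apply/(mulfI n4); rewrite mulr0 -hres.
move/eqP: ga; rewrite g0 !mulf_eq0 !subr_eq0 -orbA.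
by case/or3P=> /eqP <-; rewrite fa ?mulr0 ?mul0r.
Qed.

(** The factors [r0 - r1] and [r0 + r1] correspond to the two signs of [e]. *)
Lemma sqr_r0_r1_common_root : 2%:R != 0 :> k ->
  r0 ^+ 2 - r1 ^+ 2 = 0 <-> exists e a, e ^+ 2 = 1 /\ common_root u v w e a.
Proof.
move=> n2; split=> [/eqP | [e [a [he ha]]]].
  rewrite subr_sqr mulf_eq0 => /orP[] /eqP h.
    have m1 : (-1) ^+ 2 = 1 :> k by rewrite sqrrN expr1n.
    have [|a ha] := (common_rootP n2 m1).1; first by rewrite mulN1r.
    by exists (-1), a.
  have [|a ha] := (common_rootP n2 (expr1n _ 2)).1; first by rewrite mul1r.
  by exists 1, a; rewrite expr1n.
have h : r0 + e * r1 = 0 by apply/(common_rootP n2 he); exists a.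
have -> : r0 = - (e * r1) by apply/eqP; rewrite -addr_eq0 h.
by rewrite sqrrN exprMn he mul1r subrr.
Qed.

End Cubics.

(** * Critical points of the quartic *)

Section CriticalPoints.

Variable k : fieldType.

Definition critical (l m w x y z t : k) :=
  [/\ 3%:R * x ^+ 2 * y + t ^+ 3 + 2%:R * l * x * z ^+ 2 + w * (y * z * t) = 0,
      3%:R * y ^+ 2 * z + x ^+ 3 + 2%:R * m * y * t ^+ 2 + w * (x * z * t) = 0,
      3%:R * z ^+ 2 * t + y ^+ 3 + 2%:R * l * x ^+ 2 * z + w * (x * y * t) = 0
    & 3%:R * t ^+ 2 * x + z ^+ 3 + 2%:R * m * y ^+ 2 * t + w * (x * y * z) = 0].

(** A cyclic shift of the variables preserves the quartic up to exchanging [l] and [m], so facts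
    about [x] transfer to the other coordinates. *)
Lemma critical_rot (l m w x y z t : k) :
  critical l m w x y z t -> critical m l w y z t x.
Proof.
case=> h1 h2 h3 h4; split.
- by rewrite -[RHS]h2; ring.
- by rewrite -[RHS]h3; ring.
- by rewrite -[RHS]h4; ring.
- by rewrite -[RHS]h1; ring.
Qed.

Lemma critical_monomial (l m w x y z t : k) : 10%:R != 0 :> k ->
  critical l m w x y z t -> x ^+ 3 * y = z ^+ 3 * t.
Proof.
move=> n10 [h1 h2 h3 h4]; apply/(mulfI n10)/subr0_eq.
set f1 := (X in X = 0) in h1; set f2 := (X in X = 0) in h2.
set f3 := (X in X = 0) in h3; set f4 := (X in X = 0) in h4.
(* Each difference is free of [l], [m] and [w]; the weights 3 and 1 then eliminate [y ^+ 3 * z] and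
   [t ^+ 3 * x]. *)
have <- : 3%:R * (x * f1 - z * f3) + (y * f2 - t * f4) = 0.
  by rewrite h1 h2 h3 h4; ring.
by rewrite /f1 /f2 /f3 /f4; ring.
Qed.

Lemma critical_eq0 (l m w x y z t : k) : 10%:R != 0 :> k ->
  critical l m w x y z t -> x = 0 -> [/\ y = 0, z = 0 & t = 0].
Proof.
move=> n10 hc x0; have /eqP := critical_monomial n10 (critical_rot hc).
have cube0 (a : k) : a ^+ 3 = 0 -> a = 0 by move/eqP; rewrite expf_eq0 => /eqP.
move: hc; rewrite x0 mulr0 mulf_eq0 expf_eq0 => -[h1 _ h3 h4].
case/orP=> /eqP h; subst; (have t0 : t = 0 by apply: cube0; rewrite -h1; ring);
  subst; split=> //; apply: cube0; [rewrite -h4 | rewrite -h3]; ring.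
Qed.

Lemma critical_common_root (l m w x y z t : k) :
  10%:R != 0 :> k -> critical l m w x y z t ->
  [/\ x = 0, y = 0, z = 0 & t = 0] \/
  exists e a, e ^+ 2 = 1 /\ common_root l m w e a.
Proof.
move=> n10 hc; have hc2 := critical_rot hc.
have hc3 := critical_rot hc2; have hc4 := critical_rot hc3.
have [x0 | xn0] := eqVneq x 0; first by left; case: (critical_eq0 n10 hc x0).
have [y0 | yn0] := eqVneq y 0; first by left; case: (critical_eq0 n10 hc2 y0).
have [z0 | zn0] := eqVneq z 0; first by left; case: (critical_eq0 n10 hc3 z0).
have [t0 | tn0] := eqVneq t 0; first by left; case: (critical_eq0 n10 hc4 t0).
right; exists (x * y ^+ 2 / (z * t ^+ 2)), (x ^+ 2 / (z * t)).
have /eqP := critical_monomial n10 hc; rewrite -subr_eq0 => /eqP hxz.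
have /eqP := critical_monomial n10 hc2; rewrite -subr_eq0 => /eqP hyt.
have [h1 h2 _ _] := hc.
set g1 := (X in X = 0) in h1; set g2 := (X in X = 0) in h2.
set A := (X in X = 0) in hxz; set B := (X in X = 0) in hyt.
split; [apply/subr0_eq | split].
(* Each goal is an explicit combination of vanishing quantities: [A] and [B] give [e ^+ 2 = 1],
   while [g1] and [g2] yield the first and second cubic. *)
- transitivity ((x ^+ 3 * y * B + t ^+ 3 * x * A) / (x * z ^+ 3 * t ^+ 4)).
    by rewrite /A /B; field; rewrite ?xn0 ?yn0 ?zn0 ?tn0.
  by rewrite hxz hyt !mulr0 addr0 mul0r.
- transitivity (x ^+ 2 / (y * z ^+ 2 * t ^+ 2) * g1
    + 2%:R * l * x ^+ 3 / (y * z ^+ 3 * t ^+ 3) * A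
    + x / (y * z ^+ 2 * t ^+ 2) * B).
    by rewrite /A /B /g1; field; rewrite ?xn0 ?yn0 ?zn0 ?tn0.
  by rewrite h1 hxz hyt !mulr0 !addr0.
- transitivity (g2 / (y * t ^+ 2)
    + (x ^+ 3 / (y * z ^+ 3 * t ^+ 3) + w * x / (y * z ^+ 2 * t ^+ 2)
       + 3%:R * y / (z ^+ 2 * t ^+ 3)) * A).
    by rewrite /A /g2; field; rewrite ?xn0 ?yn0 ?zn0 ?tn0.
  by rewrite h2 hxz mul0r mulr0 addr0.
Qed.

(** At this point, modulo [e ^+ 2 = 1], the four derivatives are the first cubic, the second, and
    [e] times each of them. *)
Lemma common_root_critical (l m w e a : k) :
  e ^+ 2 = 1 -> common_root l m w e a -> critical l m w a 1 (e * a) e.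
Proof.
move=> he [h1 h2].
have e3 : e ^+ 3 = e by rewrite exprS he mulr1.
split.
- rewrite -h1 e3 exprMn he; transitivity
    (2%:R * l * a ^+ 3 + 3%:R * a ^+ 2 + w * a * e ^+ 2 + e); first by ring.
  by rewrite he mulr1.
- rewrite -h2 he; transitivity
    (a ^+ 3 + w * a ^+ 2 * e ^+ 2 + 3%:R * e * a + 2%:R * m); first by ring.
  by rewrite he mulr1.
- rewrite exprMn he -[RHS](mulr0 e) -h1; transitivity
    (e * (2%:R * l * a ^+ 3 + 3%:R * a ^+ 2 + w * a) + 1); first by ring.
  by rewrite -he; ring.
- rewrite exprMn e3 he -[RHS](mulr0 e) -h2; transitivity
    (e * (a ^+ 3 + w * a ^+ 2 + 2%:R * m) + 3%:R * a * 1); first by ring.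
  by rewrite -he; ring.
Qed.

(** * Formal partial derivatives and their evaluation *)

Lemma mderivU (n : nat) (i j : 'I_n) :
  ('X_j)^`M(i) = (j == i)%:R :> {mpoly k[n]}.
Proof.
rewrite mderivX mnm1E; case: eqP => [-> | _]; last by rewrite scale0r.
by rewrite scale1r -{1}[U_(i)%MM]add0m addmK mpolyX0.
Qed.

Lemma meval_nat (n r : nat) (v : 'I_n -> k) : (r%:R : {mpoly k[n]}).@[v] = r%:R.
Proof. by rewrite mevalMn meval1. Qed.

Lemma mderiv_exp (n r : nat) (i : 'I_n) (q : {mpoly k[n]}) :
  (q ^+ r)^`M(i) = r%:R * q ^+ r.-1 * q^`M(i).
Proof.
elim: r => [|[|r] IHr]; first by rewrite expr0 !mul0r -mpolyC1 mderivC.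
  by rewrite expr1 !mul1r.
by rewrite exprS mderivM IHr -[in RHS]natr1 /= exprS; ring.
Qed.

Lemma meval_exp (n r : nat) (v : 'I_n -> k) (q : {mpoly k[n]}) :
  (q ^+ r).@[v] = q.@[v] ^+ r.
Proof. exact: rmorphXn. Qed.

(** The Kronecker factors let one computation cover all four indices. *)
Lemma meval_mderiv_quartic (l m w : k) (p : 'I_4 -> k) (i : 'I_4) :
  let x := p (@Ordinal 4 0 isT) in let y := p (@Ordinal 4 1 isT) in
  let z := p (@Ordinal 4 2 isT) in let t := p (@Ordinal 4 3 isT) in
  ((quartic l m w)^`M(i)).@[p] =
  (3%:R * x ^+ 2 * y + t ^+ 3 + 2%:R * l * x * z ^+ 2 + w * (y * z * t))
    * (@Ordinal 4 0 isT == i)%:R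
  + (3%:R * y ^+ 2 * z + x ^+ 3 + 2%:R * m * y * t ^+ 2 + w * (x * z * t))
    * (@Ordinal 4 1 isT == i)%:R
  + (3%:R * z ^+ 2 * t + y ^+ 3 + 2%:R * l * x ^+ 2 * z + w * (x * y * t))
    * (@Ordinal 4 2 isT == i)%:R
  + (3%:R * t ^+ 2 * x + z ^+ 3 + 2%:R * m * y ^+ 2 * t + w * (x * y * z))
    * (@Ordinal 4 3 isT == i)%:R.
Proof.
rewrite /quartic !(mderivU, mderiv_exp, mderivM, mderivZ, mderivD).
rewrite !(meval_nat, mevalXU, meval_exp, mevalM, mevalZ, mevalD).
by rewrite -!val_eqE /=; ring.
Qed.

Lemma gradient_quarticP (l m w : k) (p : 'I_4 -> k) :
  (forall i, ((quartic l m w)^`M(i)).@[p] = 0)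
  <-> critical l m w (p (@Ordinal 4 0 isT)) (p (@Ordinal 4 1 isT))
        (p (@Ordinal 4 2 isT)) (p (@Ordinal 4 3 isT)).
Proof.
split=> [h | [h1 h2 h3 h4] i]; last first.
  by rewrite meval_mderiv_quartic h1 h2 h3 h4 !mul0r !addr0.
split; [ have := h (@Ordinal 4 0 isT) | have := h (@Ordinal 4 1 isT)
       | have := h (@Ordinal 4 2 isT) | have := h (@Ordinal 4 3 isT) ];
  by rewrite meval_mderiv_quartic /= !mulr0 ?addr0 ?add0r mulr1.
Qed.

End CriticalPoints.

Theorem theorem3p7 (k : closedFieldType) (char0 : [pchar k] =i pred0)
    (lambda mu xi : k) :
  singular (quartic lambda mu xi)
  <-> (R k).@[tnth [tuple lambda; mu; xi]] = 0.
Proof.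
have n0 n : n.+1%:R != 0 :> k by rewrite (pcharf0P k).1.
have R_rootP : (R k).@[tnth [tuple lambda; mu; xi]] = 0 <->
    exists e a, e ^+ 2 = 1 /\ common_root lambda mu xi e a.
  rewrite -sqr_r0_r1_common_root // /R /R0 /R1.
  by rewrite !(meval_nat, mevalXU, meval_exp, mevalM, mevalN, mevalD).
split=> [sing | /R_rootP[e [a [he ha]]] nonsing].
  (* As [singular] is a negation, a nonzero value of [R] is assumed: no common root exists, so every
     critical point is zero. *)
  apply/eqP; case: eqP => // Rn0; case: sing => p.
  move=> /gradient_quarticP /(critical_common_root (n0 9)).
  case=> [[x0 y0 z0 t0] | /R_rootP //].
  by apply/rowP=> -[[|[|[|[|i]]]] hi] //; rewrite (bool_irrelevance hi isT) mxE.
pose p : 'rV[k]_4 := \row_j tnth [tuple a; 1; e * a; e] j.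
have p0 : p = 0.
  by apply: nonsing; apply/gradient_quarticP; rewrite !mxE;
    apply: common_root_critical.
(* The second coordinate of [p] is 1, so [p] cannot be zero. *)
have := congr1 (fun q : 'rV[k]_4 => q 0 (@Ordinal 4 1 isT)) p0.
by rewrite !mxE => /eqP; rewrite oner_eq0.
Qed.
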